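(* Let $m\ge2$, let $q_1,\dots,q_m$ be nonzero integers, and let $n$ be a prime. Let $A$ be the $m\times m$ integer matrix whose first row is $(1,1,\dots,1)$ and whose $i$-th row, for $2\le i\le m$, has entry $-q_1$ in column $1$, entry $q_i$ in column $i$, and $0$ in all other columns. If at least one of the $q_i$ is divisible by $n$, then the mod $n$ nullity of $A$ equals $$\#\{\,i\in\{1,\dots,m\} : n\mid q_i\,\}-1.$$
   Context: The mod $n$ nullity of an integer matrix, for $n$ prime, is the dimension over $\mathbb{Z}/n\mathbb{Z}$ of the null space of its reduction modulo $n$. The matrix $A$ is the coefficient matrix of the linear system $d_1+\cdots+d_m=0$, $-q_1d_1+q_id_i=0$ ($2\le i\le m$), associated to the pretzel knot $P(q_1,\dots,q_m)$ with $m$ twist regions, the $i$-th of which has $q_i$ half-twists ($q_i$ may be positive or negative). *)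

(* Defs.v *)
From mathcomp Require Import all_boot all_order all_algebra.

Set Implicit Arguments.
Unset Strict Implicit.
Unset Printing Implicit Defensive.

Import GRing.Theory.
Local Open Scope ring_scope.

(* The null space is that of A acting on column vectors, x |-> A x; the kernel
   [kermx] would be the left one. ['F_n] is Z/nZ only for n prime. *)
Definition mod_nullity (n r c : nat) (A : 'M[int]_(r, c)) : nat :=
  let An : 'M['F_n]_(r, c) := map_mx intr A in
  \dim (lker (linfun (fun x : 'cV['F_n]_c => An *m x))).

(* Indices are shifted by one: q_1, ..., q_m are the values of q at 0, ..., m-1.
   In the column j = 0, [q j] is q_1. *)
Definition pretzel_mx (m : nat) (q : 'I_m -> int) : 'M[int]_m :=
  \matrix_(i < m, j < m)
    if val i == 0%N then 1
    else if val j == 0%N then - q j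
    else if j == i then q i
    else 0.

(* Main.v *)
Require Import Defs.
From mathcomp Require Import all_boot all_order all_algebra.

(** Some [q k] vanishes modulo [n], and the rows of the system say that all the
    products [q i * x i] are equal, so modulo [n] all of them are zero: a
    solution is exactly a vector with coordinate sum zero and supported on
    [S = {i : n divides q i}] ([pretzel_kerP]). The vectors [e_i - e_k], for [i]
    in [S] other than [k], form a basis of the space of these vectors
    ([mem_sum_diff_line] and [dim_sum_diff_line]), which thus has dimension
    [#|S| - 1]. *)

Import GRing.Theory.
Local Open Scope ring_scope.

Lemma dvdz_Fp (n : nat) (a : int) :
  prime n -> (n%:Z %| a)%Z = (a%:~R == 0 :> 'F_n).
Proof. by move=> pr_n; rewrite (dvdz_pcharf (pchar_Fp pr_n)). Qed.

(** Here [a] stands for the reduction of [q], and the existence of a zero of [a]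
    is what forces the common value of the [a i * x i] to be zero. *)
Lemma pretzel_kerP (n m : nat) (q : 'I_m -> int) (x : 'cV['F_n]_m) (k : 'I_m)
    (a := fun i => (q i)%:~R : 'F_n) :
  a k = 0 ->
  map_mx intr (pretzel_mx q) *m x = 0 <->
  \sum_i x i 0 = 0 /\ (forall i, a i != 0 -> x i 0 = 0).
Proof.
move=> ak0; have m_gt0 : (0 < m)%N by case: k {ak0} => k /(leq_ltn_trans (leq0n k)).
pose i0 := Ordinal m_gt0.
have rowE i : (map_mx intr (pretzel_mx q) *m x) i 0 =
    if i == i0 then \sum_j x j 0 else a i * x i 0 - a i0 * x i0 0.
  rewrite mxE; have [->|ni0] := eqVneq i i0.
    by apply: eq_bigr => j _; rewrite !mxE /= mul1r.
  have vi : (val i == 0%N) = false by apply: contraNF ni0 => /eqP vi; exact/eqP/val_inj.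
  rewrite (bigD1 i) //= (bigD1 i0) ?(eq_sym i0) //= big1 => [|j /andP[ji ji0]].
    by rewrite !mxE /= vi eqxx addr0 rmorphN mulNr.
  rewrite !mxE vi (negPf ji); have -> : (val j == 0%N) = false.
    by apply: contraNF ji0 => /eqP vj; exact/eqP/val_inj.
  by rewrite rmorph0 mul0r.
split=> [Ax0 | [sx0 x0]]; last first.
  have ax0 i : a i * x i 0 = 0.
    by have [->|/x0->] := eqVneq (a i) 0; rewrite (mul0r, mulr0).
  by apply/colP => i; rewrite rowE mxE !ax0 subrr sx0 if_same.
have row0 i : (map_mx intr (pretzel_mx q) *m x) i 0 = 0 by rewrite Ax0 mxE.
have ax_const i : a i * x i 0 = a i0 * x i0 0.
  have [->//|ni0] := eqVneq i i0.
  by apply/eqP; rewrite -subr_eq0; have := row0 i; rewrite rowE (negPf ni0) => ->.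
split=> [|i ai_neq0]; first by have := row0 i0; rewrite rowE eqxx.
have /eqP : a i * x i 0 = 0 by rewrite ax_const -(ax_const k) ak0 mul0r.
by rewrite mulf_eq0 (negPf ai_neq0) => /eqP.
Qed.

Section ZeroSum.

Variables (F : fieldType) (m : nat) (S : {set 'I_m}) (k : 'I_m).

(** The difference [e_i - e_k] of two standard basis vectors. *)
Definition diff_vec (i : 'I_m) : 'cV[F]_m := delta_mx i 0 - delta_mx k 0.

Lemma diff_vecE i j : diff_vec i j 0 = (j == i)%:R - (j == k)%:R.
Proof. by rewrite !mxE !eqxx !andbT. Qed.

Lemma sum_diff_vecE (c : 'I_m -> F) i :
  i != k -> i \in S -> (\sum_(j in S :\ k) c j *: diff_vec j) i 0 = c i.
Proof.
move=> nik iS; rewrite summxE (bigD1 i) ?in_setD1 ?nik //= big1 => [|j /andP[_ ji]].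
  by rewrite mxE diff_vecE eqxx (negPf nik) subr0 mulr1 addr0.
by rewrite mxE diff_vecE eq_sym (negPf ji) (negPf nik) subr0 mulr0.
Qed.

Lemma dim_sum_diff_line :
  \dim (\sum_(i in S :\ k) <[diff_vec i]>)%VS = #|S :\ k|.
Proof.
have /directvP -> : directv (\sum_(i in S :\ k) <[diff_vec i]>).
  apply/directv_sum_independent => u uP u0 i iSk.
  have /fin_all_exists[c uE] j : exists c, j \in S :\ k -> u j = c *: diff_vec j.
    case jSk : (j \in S :\ k); last by exists 0.
    by have /vlineP[c ->] := uP j jSk; exists c.
  have /setD1P[nik iS] := iSk.
  rewrite uE // -(sum_diff_vecE c _ nik iS).
  by rewrite -(eq_bigr _ uE) u0 mxE scale0r.
rewrite /= -sum1_card; apply: eq_bigr => i /setD1P[nik _].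
rewrite dim_vline; case: eqP => // /colP/(_ i)/eqP.
by rewrite diff_vecE mxE eqxx (negPf nik) subr0 oner_eq0.
Qed.

Lemma mem_sum_diff_line (x : 'cV[F]_m) :
  k \in S ->
  x \in (\sum_(i in S :\ k) <[diff_vec i]>)%VS <->
  \sum_i x i 0 = 0 /\ (forall i, i \notin S -> x i 0 = 0).
Proof.
move=> kS; split=> [/memv_sumP[u uP ->] | [sx0 x0]].
  split=> [|i niS].
    under eq_bigr do rewrite summxE.
    rewrite exchange_big big1 //= => j /uP/vlineP[c ->].
    under eq_bigr do rewrite mxE diff_vecE.
    rewrite -mulr_sumr sumrB (bigD1 j) //= (bigD1 (F := fun i => (i == k)%:R) k) //=.
    by rewrite !eqxx !big1 ?addr0 ?subrr ?mulr0 // => i /negPf->.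
  rewrite summxE big1 // => j jSk; have /vlineP[c ->] := uP j jSk.
  have /setD1P[_ jS] := jSk.
  rewrite mxE diff_vecE; have [ij|_] := eqVneq i j; first by rewrite ij jS in niS.
  have [ik|_] := eqVneq i k; first by rewrite ik kS in niS.
  by rewrite subrr mulr0.
have -> : x = \sum_(j in S :\ k) x j 0 *: diff_vec j.
  apply/colP => i; have [->|nik] := eqVneq i k.
    (* The coordinate at [k] is determined by the sum being zero. *)
    rewrite summxE; move/eqP: sx0; rewrite (bigD1 k) //= addr_eq0 => /eqP->.
    rewrite -sumrN (bigID (mem S)) /= [X in _ + X]big1 ?addr0; last first.
      by move=> j /andP[_ /x0->]; rewrite oppr0.
    apply: eq_big => [j | j /andP[njk _]]; first by rewrite in_setD1.
    by rewrite mxE diff_vecE eq_sym (negPf njk) eqxx sub0r mulrN1.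
  have [iS|niS] := boolP (i \in S); first by rewrite sum_diff_vecE.
  rewrite x0 // summxE big1 // => j /setD1P[_ jS].
  rewrite mxE diff_vecE (negPf nik) subr0; have [ij|_] := eqVneq i j.
    by rewrite ij jS in niS.
  by rewrite mulr0.
by apply: memv_sumr => j jSk; rewrite memvZ // memv_line.
Qed.

End ZeroSum.

Theorem claim20 (m : nat) (q : 'I_m -> int) (n : nat)
    (hm : (2 <= m)%N)
    (hq : forall i : 'I_m, q i != 0)
    (hn : prime n)
    (hdvd : exists i : 'I_m, (n%:Z %| q i)%Z) :
  (mod_nullity n (pretzel_mx q))%:Z
    = #|[set i : 'I_m | (n%:Z %| q i)%Z]|%:Z - 1.
Proof.
have [k kdvd] := hdvd; set S := [set i | _].
have kS : k \in S by rewrite inE.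
have qk0 : (q k)%:~R = 0 :> 'F_n by apply/eqP; rewrite -dvdz_Fp.
suff -> : mod_nullity n (pretzel_mx q) = #|S :\ k|.
  by rewrite (cardsD1 k S) kS PoszD addrC addKr.
rewrite -(dim_sum_diff_line 'F_n) /mod_nullity; congr (\dim _).
apply/vspaceP => x; rewrite memv_ker (lfunE (mulmx _)) /=.
have notS i : (i \notin S) = ((q i)%:~R != 0 :> 'F_n) by rewrite inE dvdz_Fp.
apply/eqP/idP => [/(pretzel_kerP _ _ _ _ _ qk0)[sx0 x0] | ].
  by apply/(mem_sum_diff_line _ _ _ _ _ kS); split=> // i; rewrite notS; apply: x0.
move/(mem_sum_diff_line _ _ _ _ _ kS) => [sx0 x0].
by apply/(pretzel_kerP _ _ _ _ _ qk0); split=> // i; rewrite -notS; apply: x0.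
Qed.
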